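(* Let $G$ be a finitely generated group, $N\le G$ a subgroup, $\phi:N\to G$ a monomorphism, and let $G\ast_N$ be the HNN-extension of $G$ over $N$ with respect to $\phi$. Then $$\operatorname{asdim}(G\ast_N)\le \max\{\operatorname{asdim} G,\ \operatorname{asdim} N+1\}.$$
   Context: For a metric space $X$, $\operatorname{asdim}X\le n$ means: for every $R>0$ there is a covering $\mathcal U$ of $X$ by sets of uniformly bounded diameter such that every $R$-ball in $X$ intersects at most $n+1$ elements of $\mathcal U$; $\operatorname{asdim}X$ is the least such $n$ ($\infty$ if there is none). A finitely generated group is viewed as a metric space with the word metric of a finite generating set (asdim does not depend on the choice); a subgroup of a finitely generated group, such as $N\le G$, carries the restricted metric. The HNN-extension is $G\ast_N=\langle G,t\mid tnt^{-1}=\phi(n),\ n\in N\rangle$. The subgroup $N$ is not assumed finitely generated. *)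

(* Defs.v *)
From HB Require Import structures.
From mathcomp Require Import all_boot all_order all_algebra generic_quotient.
From mathcomp Require Import all_classical all_reals all_analysis.

Set Implicit Arguments.
Unset Strict Implicit.
Unset Printing Implicit Defensive.

Import Order.TTheory GRing.Theory Num.Theory.
Local Open Scope classical_set_scope.
Local Open Scope card_scope.
Local Open Scope ring_scope.

Definition asdim_le (R : realType) (X : metricType R) (n : nat) : Prop :=
  forall r : R, 0 < r -> exists U : set (set X),
    [/\ \bigcup_(A in U) A = setT,
        (exists D : R, forall A, U A -> forall x y, A x -> A y -> mdist x y <= D)
      & forall x : X, [set A | U A /\ A `&` ball x r !=set0] #<= `I_n.+1].

(* The infimum of the empty set is +oo, the value taken when no n works. *)
Definition asdim (R : realType) (X : metricType R) : \bar R :=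
  ereal_inf [set n%:R%:E | n in asdim_le X].

Section RestrictedMetric.
Variables (R : realType) (X : metricType R) (A : set X).

Definition sub_mdist (x y : set_type A) : R := mdist (set_val x) (set_val y).

Lemma sub_mdist_ge0 x y : 0 <= sub_mdist x y.
Proof. exact: mdist_ge0. Qed.

Lemma sub_mdist_positivity x y : sub_mdist x y = 0 -> x = y.
Proof. by move=> /mdist_positivity /val_inj. Qed.

Lemma sub_ballEmdist x d : ball x d = [set y | sub_mdist x y < d].
Proof.
rewrite -[LHS]/(set_val @^-1` (ball (set_val x) d)).
by apply/seteqP; split => y; rewrite /= ballEmdist.
Qed.

HB.instance Definition _ := PseudoMetric_isMetric.Build R (set_type A)
  sub_mdist_ge0 sub_mdist_positivity sub_ballEmdist.

Lemma mdist_set_type (x y : set_type A) : mdist x y = mdist (set_val x) (set_val y).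
Proof. by []. Qed.

End RestrictedMetric.

Section WordMetric.
Local Open Scope group_scope.
Variable G : groupType.

Definition is_word (S : seq G) (w : seq G) : bool :=
  all (fun x => (x \in S) || (x^-1 \in S)) w.

Definition generates (S : seq G) : Prop :=
  forall g : G, exists w : seq G, is_word S w /\ g = \prod_(x <- w) x.

Variables (S : seq G) (genS : generates S).

Definition has_word_of_size (g : G) (n : nat) : bool :=
  `[< exists w : seq G, [/\ is_word S w, size w = n & g = \prod_(x <- w) x] >].

Lemma ex_word_of_size g : exists n, has_word_of_size g n.
Proof. by have [w [Sw ->]] := genS g; exists (size w); apply/asboolP; exists w. Qed.

Definition word_norm (g : G) : nat := ex_minn (ex_word_of_size g).

Lemma word_norm_le w : is_word S w -> (word_norm (\prod_(x <- w) x) <= size w)%N.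
Proof.
move=> Sw; rewrite /word_norm; case: ex_minnP => m _; apply.
by apply/asboolP; exists w.
Qed.

Lemma word_normP g :
  exists w, [/\ is_word S w, size w = word_norm g & g = \prod_(x <- w) x].
Proof. by rewrite /word_norm; case: ex_minnP => m /asboolP. Qed.

Lemma word_norm1 : word_norm 1 = 0%N.
Proof.
by apply/eqP; rewrite -leqn0; have := @word_norm_le [::] isT; rewrite big_nil.
Qed.

Lemma word_norm_eq0 g : word_norm g = 0%N -> g = 1.
Proof. by have [w [_ <- ->]] := word_normP g => /size0nil ->; rewrite big_nil. Qed.

Lemma word_normM g h : (word_norm (g * h) <= word_norm g + word_norm h)%N.
Proof.
have [u [Su <- ug]] := word_normP g; have [v [Sv <- vh]] := word_normP h.
rewrite [in X in (X <= _)%N]ug [in X in (X <= _)%N]vh -big_cat -size_cat.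
by apply: word_norm_le; rewrite /is_word all_cat [all _ u]Su.
Qed.

Lemma word_normV_le g : (word_norm g^-1 <= word_norm g)%N.
Proof.
have [w [Sw <- ->]] := word_normP g.
have -> : (\prod_(x <- w) x)^-1 = \prod_(x <- rev (map (@monoid.inv G) w)) x.
  elim: w {Sw} => [|x w IHw]; first by rewrite !big_nil invg1.
  by rewrite big_cons invgM IHw /= rev_cons -cats1 big_cat big_seq1.
rewrite -(size_map (@monoid.inv G)) -size_rev; apply: word_norm_le.
rewrite /is_word all_rev all_map; apply: sub_all Sw => x /=.
by rewrite invgK orbC.
Qed.

Lemma word_normV g : word_norm g^-1 = word_norm g.
Proof.
by apply/eqP; rewrite eqn_leq word_normV_le -[X in (word_norm X <= _)%N]invgK
  word_normV_le.
Qed.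

End WordMetric.

(* A copy of G carrying the word metric d(g, h) = |g^-1 h| of S. *)
Definition word_space (R : realType) (G : groupType) (S : seq G)
  (genS : generates S) : Type := G.

Section WordSpace.
Variables (R : realType) (G : groupType) (S : seq G) (genS : generates S).

HB.instance Definition _ := Choice.copy (word_space R genS) G.

Definition word_dist (g h : word_space R genS) : R :=
  (word_norm genS ((g : G)^-1 * (h : G))%g)%:R.

Lemma word_distxx g : word_dist g g = 0.
Proof. by rewrite /word_dist mulVg word_norm1. Qed.

Lemma word_dist_positivity g h : word_dist g h = 0 -> g = h.
Proof.
move=> /eqP; rewrite pnatr_eq0 => /eqP /word_norm_eq0 gh.
by rewrite -[LHS](@mulg1 G) -gh mulVKg.
Qed.

Lemma word_dist_sym g h : word_dist g h = word_dist h g.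
Proof. by rewrite /word_dist -word_normV invgM invgK. Qed.

Lemma word_dist_triangle h g k : word_dist g k <= word_dist g h + word_dist h k.
Proof.
rewrite /word_dist -natrD ler_nat.
have -> : ((g : G)^-1 * k = (g : G)^-1 * h * ((h : G)^-1 * k))%g.
  by rewrite -mulgA mulVKg.
exact: word_normM.
Qed.

HB.instance Definition _ := isMetric.Build R (word_space R genS)
  word_distxx word_dist_positivity word_dist_sym word_dist_triangle.

Lemma mdist_word_space (g h : G) :
  mdist (g : word_space R genS) (h : word_space R genS) =
  (word_norm genS (g^-1 * h)%g)%:R.
Proof. by []. Qed.

End WordSpace.

Definition subgroup (G : groupType) (N : groupClosed G) : Type := {x : G | x \in N}.

Section Subgroup.
Variables (G : groupType) (N : groupClosed G).

Lemma N_group_closed : group_closed N.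
Proof. by split; [exact: gpred1 | exact: gpredF]. Qed.

HB.instance Definition _ := SubChoice.copy (subgroup N) {x : G | x \in N}.
HB.instance Definition _ :=
  SubChoice_isSubGroup.Build G (mem N) (subgroup N) N_group_closed.

End Subgroup.

Section HNN.
Local Open Scope group_scope.
Variables (G : groupType) (N : groupClosed G).
Variable phi : {multiplicative subgroup N -> G}.

(* Words in the elements of G and in t = inr false, t^-1 = inr true. *)
Definition hnn_word : Type := seq (G + bool).

(* The congruence on words generated by the multiplication table of G, by
   t t^-1 = t^-1 t = 1 and by t n t^-1 = phi n for n in N; the quotient is the
   group < G, t | t n t^-1 = phi n, n in N >. *)
Inductive hnn_eq : hnn_word -> hnn_word -> Prop :=
| hnn_refl u : hnn_eq u u
| hnn_sym u v : hnn_eq u v -> hnn_eq v u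
| hnn_trans v u w : hnn_eq u v -> hnn_eq v w -> hnn_eq u w
| hnn_cat u u' v v' : hnn_eq u u' -> hnn_eq v v' -> hnn_eq (u ++ v) (u' ++ v')
| hnn_one : hnn_eq [:: inl 1] [::]
| hnn_mul g h : hnn_eq [:: inl g; inl h] [:: inl (g * h)]
| hnn_cancel b : hnn_eq [:: inr b; inr (~~ b)] [::]
| hnn_conj (n : subgroup N) :
    hnn_eq [:: inr false; inl (val n); inr true] [:: inl (phi n)].

Definition hnn_rel : rel hnn_word := fun u v => `[< hnn_eq u v >].

Lemma hnn_rel_refl : reflexive hnn_rel.
Proof. by move=> u; apply/asboolP; exact: hnn_refl. Qed.

Lemma hnn_rel_sym : symmetric hnn_rel.
Proof. by move=> u v; apply/asboolP/asboolP; exact: hnn_sym. Qed.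

Lemma hnn_rel_trans : transitive hnn_rel.
Proof.
by move=> v u w /asboolP uv /asboolP vw; apply/asboolP; exact: hnn_trans vw.
Qed.

Canonical hnn_equiv := EquivRel hnn_rel hnn_rel_refl hnn_rel_sym hnn_rel_trans.

Definition HNN : Type := {eq_quot hnn_equiv}%qT.

HB.instance Definition _ := EqQuotient.on HNN.
HB.instance Definition _ := Choice.on HNN.

Definition hnn_class (u : hnn_word) : HNN := (\pi_HNN u)%qT.

Lemma hnn_classP u v : hnn_class u = hnn_class v <-> hnn_eq u v.
Proof.
split=> [/eqquotP /asboolP //|uv].
by apply/eqquotP/asboolP.
Qed.

Lemma hnn_class_repr (x : HNN) : hnn_class (repr x) = x.
Proof. exact: reprK. Qed.

Lemma hnn_repr_class u : hnn_eq (repr (hnn_class u)) u.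
Proof. by apply/hnn_classP; rewrite hnn_class_repr. Qed.

Definition hnn_letter_inv (a : G + bool) : G + bool :=
  match a with inl g => inl g^-1 | inr b => inr (~~ b) end.

Definition hnn_word_inv (u : hnn_word) : hnn_word := rev (map hnn_letter_inv u).

Definition hnn_mulf (x y : HNN) : HNN := hnn_class (repr x ++ repr y).
Definition hnn_invf (x : HNN) : HNN := hnn_class (hnn_word_inv (repr x)).

Lemma hnn_mulf_class u v : hnn_mulf (hnn_class u) (hnn_class v) = hnn_class (u ++ v).
Proof. by apply/hnn_classP/hnn_cat; exact: hnn_repr_class. Qed.

Lemma hnn_mulfA : associative hnn_mulf.
Proof.
move=> x y z; rewrite -(hnn_class_repr x) -(hnn_class_repr y) -(hnn_class_repr z).
by rewrite !hnn_mulf_class catA.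
Qed.

Lemma hnn_mul1f : left_id (hnn_class [::]) hnn_mulf.
Proof. by move=> x; rewrite -(hnn_class_repr x) hnn_mulf_class. Qed.

Lemma hnn_mulf1 : right_id (hnn_class [::]) hnn_mulf.
Proof. by move=> x; rewrite -(hnn_class_repr x) hnn_mulf_class cats0. Qed.

Lemma hnn_word_invK : involutive hnn_word_inv.
Proof.
move=> u; rewrite /hnn_word_inv map_rev revK mapK //.
by case=> [g|b] /=; rewrite ?invgK ?negbK.
Qed.

Lemma hnn_word_mulV u : hnn_eq (u ++ hnn_word_inv u) [::].
Proof.
elim: u => [|a u IHu]; first exact: hnn_refl.
have aV : hnn_eq [:: a; hnn_letter_inv a] [::].
  case: a => [g|b]; last exact: hnn_cancel.
  by apply: hnn_trans hnn_one; rewrite -(mulgV g); exact: hnn_mul.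
rewrite /hnn_word_inv /= rev_cons -cats1 catA.
apply: hnn_trans aV; rewrite -[_ :: _ ++ _]cat1s -[[:: a; _]]cat1s.
apply: (hnn_cat (hnn_refl _)); rewrite -[X in hnn_eq _ X]cat0s.
exact: (hnn_cat IHu (hnn_refl _)).
Qed.

Lemma hnn_mulVf : left_inverse (hnn_class [::]) hnn_invf hnn_mulf.
Proof.
move=> x; rewrite -{2}(hnn_class_repr x) hnn_mulf_class; apply/hnn_classP.
by rewrite -{2}(hnn_word_invK (repr x)); exact: hnn_word_mulV.
Qed.

Lemma hnn_mulfV : right_inverse (hnn_class [::]) hnn_invf hnn_mulf.
Proof.
move=> x; rewrite -{1}(hnn_class_repr x) hnn_mulf_class; apply/hnn_classP.
exact: hnn_word_mulV.
Qed.

HB.instance Definition _ := isGroup.Build HNN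
  hnn_mulfA hnn_mul1f hnn_mulf1 hnn_mulVf hnn_mulfV.

Definition hnn_in (g : G) : HNN := hnn_class [:: inl g].
Definition hnn_t : HNN := hnn_class [:: inr false].

Lemma hnn_classM u v : hnn_class u * hnn_class v = hnn_class (u ++ v).
Proof. exact: hnn_mulf_class. Qed.

Lemma hnn_inM : {morph hnn_in : g h / g * h}.
Proof. by move=> g h; rewrite hnn_classM; apply/esym/hnn_classP/hnn_mul. Qed.

Lemma hnn_in1 : hnn_in 1 = 1.
Proof. exact/hnn_classP/hnn_one. Qed.

HB.instance Definition _ := isUMagmaMorphism.Build G HNN hnn_in (hnn_in1, hnn_inM).

Lemma hnn_tV : hnn_t^-1 = hnn_class [:: inr true].
Proof.
by apply: mulg1_eq; rewrite hnn_classM; apply/hnn_classP; exact: hnn_cancel.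
Qed.

Lemma hnn_tJ (n : subgroup N) : hnn_t * hnn_in (val n) * hnn_t^-1 = hnn_in (phi n).
Proof. by rewrite hnn_tV /hnn_t /hnn_in !hnn_classM; apply/hnn_classP/hnn_conj. Qed.

Lemma generates_HNN (S : seq G) :
  generates S -> generates (rcons (map hnn_in S) hnn_t).
Proof.
move=> genS; set S' := rcons _ _.
have S'M x y : (exists w, is_word S' w /\ x = \prod_(z <- w) z) ->
    (exists w, is_word S' w /\ y = \prod_(z <- w) z) ->
    exists w, is_word S' w /\ x * y = \prod_(z <- w) z.
  move=> [u [Su ->]] [v [Sv ->]]; exists (u ++ v); rewrite big_cat.
  by split=> //; rewrite /is_word all_cat [all _ u]Su.
have tS' : hnn_t \in S' by rewrite mem_rcons mem_head.
move=> x; rewrite -(hnn_class_repr x); elim: (repr x : hnn_word) => [|a u IHu].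
  by exists [::]; rewrite big_nil.
rewrite -cat1s -hnn_classM; apply: S'M IHu; case: a => [g|[]].
- have [w [Sw ->]] := genS g; exists (map hnn_in w); split.
    rewrite /is_word all_map; apply: sub_all Sw => z /= zS.
    rewrite -gmulfV !mem_rcons !inE.
    by case/orP: zS => zS; rewrite (map_f hnn_in zS) !orbT.
  by rewrite big_map -/(hnn_in _) gmulf_prod.
- exists [:: hnn_t^-1]; rewrite big_seq1 hnn_tV; split=> //.
  by rewrite /is_word /= -hnn_tV invgK tS' orbT.
- by exists [:: hnn_t]; rewrite big_seq1 /is_word /= tS'.
Qed.

Lemma HNN_universal (K : groupType) (f : G -> K) (s : K) :
    {morph f : g h / g * h} ->
    (forall n : subgroup N, s * f (val n) * s^-1 = f (phi n)) ->
  exists! F : HNN -> K,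
    [/\ {morph F : x y / x * y}, forall g, F (hnn_in g) = f g & F hnn_t = s].
Proof.
move=> fM fJ; have f1 : f 1 = 1.
  by apply: (@mulgI _ (f 1)); rewrite -fM !mulg1.
pose e (a : G + bool) := match a with inl g => f g | inr b => if b then s^-1 else s end.
pose ev (u : hnn_word) := \prod_(a <- u) e a.
have evE u v : hnn_eq u v -> ev u = ev v.
  rewrite /ev; elim=> {u v} //.
  - by move=> v u w _ -> _ ->.
  - by move=> u u' v v' _ uu' _ vv'; rewrite !big_cat /= uu' vv'.
  - by rewrite big_seq1 big_nil.
  - by move=> g h; rewrite !big_cons !big_nil !mulg1 /= fM.
  - by case; rewrite !big_cons !big_nil !mulg1 /= ?mulVg ?mulgV.
  - by move=> n; rewrite !big_cons !big_nil !mulg1 /= mulgA fJ.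
have evC u : ev (repr (hnn_class u)) = ev u by apply/evE/hnn_repr_class.
exists (fun x => ev (repr x)); split=> [|F [FM Fin Ft]].
  split=> [x y|g|]; last 2 first.
  - by rewrite evC /ev big_seq1.
  - by rewrite evC /ev big_seq1.
  rewrite -{1}(hnn_class_repr x) -{1}(hnn_class_repr y) hnn_classM evC.
  by rewrite /ev big_cat.
have F1 : F 1 = 1 by apply: (@mulgI _ (F 1)); rewrite -FM !mulg1.
apply/funext => x; rewrite -[in RHS](hnn_class_repr x).
elim: (repr x : hnn_word) => [|a u IHu]; first by rewrite /ev big_nil F1.
rewrite /ev big_cons -/(ev u) IHu -cat1s -hnn_classM FM; congr (_ * _).
case: a => [g|[]] /=; rewrite ?Fin ?Ft //.
by rewrite -hnn_tV; apply: mulg1_eq; rewrite -{1}Ft -FM mulgV F1.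
Qed.

End HNN.

(* Main.v *)
Require Import Defs.
From mathcomp Require Import all_boot all_order all_algebra generic_quotient.
From mathcomp Require Import all_classical all_reals all_analysis.
From mathcomp Require Import finmap zify lra.

(** Asymptotic dimension at most [n] is equivalent to the following: for every
scale [r] the space has a coloring by [n + 1] colors such that the monochromatic
[r]-chains have uniformly bounded diameter ([asdim_le_colorable],
[colorable_asdim_le]). This formulation behaves well under left translations,
bounded thickenings, injective homomorphisms ([colorable_image]) and unions
([components_bounded_union]), and the proof constructs such a coloring of the
HNN-extension.

The HNN-extension acts on its Bass-Serre tree. The tree is given concretely by
normal forms: the letters act on normal forms from the right, a vertex is the
list of syllables of a normal form, and a letter [t] or its inverse adds or
removes one syllable. Consequently a path that leaves a subtree passes near the
coset of [N] attached to the edge at its root ([subtree_exit]).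

Let [n] be at least asdim G and at least asdim N + 1, and let [r] be a scale.
Over a ball of the tree, [n + 1] colors suffice at every scale, with bounds
depending only on the radius ([colorable_level_ball]). To pass to the whole group
it is cut along shells: at every vertex [w] whose level is a multiple of a large
constant, the shell consists of the points over the subtree at [w] whose distance
from the complement of this subtree is between [r] and [(n + 2) r]. Shells are
[r]-disjoint and lie near cosets of [N], so their union has [n] colors at scale
[r], with a bound [D0] that depends only on [n] and [r]. Now the shells, of
thickness [(n + 1) r], are subdivided into layers [0, ..., n] of thickness [r],
and in layer [k] the [n] colors are renamed to be all of [0, ..., n] except [k].
No monochromatic chain of color [i] crosses layer [i] of a shell, so it remains in
a region which is bounded in the tree direction. The part of the region outside
the shells is colored at a scale beyond [D0], and the union lemma bounds the
chain ([coloring_HNN]). *)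

Set Implicit Arguments.
Unset Strict Implicit.
Unset Printing Implicit Defensive.

Local Open Scope classical_set_scope.

(** * Chains, components and colorings *)

Section WordDistance.
Local Open Scope group_scope.
Variables (K : groupType) (S : seq K) (genS : generates S).

Definition wdist (x y : K) : nat := word_norm genS (x^-1 * y).

Lemma wdistxx x : wdist x x = 0%N.
Proof. by rewrite /wdist mulVg word_norm1. Qed.

Lemma wdist_sym x y : wdist x y = wdist y x.
Proof. by rewrite /wdist -word_normV invgM invgK. Qed.

Lemma wdist_triangle y x z : (wdist x z <= wdist x y + wdist y z)%N.
Proof.
rewrite /wdist; have -> : x^-1 * z = x^-1 * y * (y^-1 * z) by rewrite -mulgA mulVKg.
exact: word_normM.
Qed.

Lemma wdist_leD y x z a b :
  (wdist x y <= a -> wdist y z <= b -> wdist x z <= a + b)%N.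
Proof. by move=> xy yz; apply: leq_trans (wdist_triangle y x z) (leq_add xy yz). Qed.

Lemma wdist_mul g x y : wdist (g * x) (g * y) = wdist x y.
Proof. by rewrite /wdist invgM -mulgA mulKg. Qed.

Lemma wdist_translate g x y : wdist (g^-1 * x) (g^-1 * y) = wdist x y.
Proof. exact: wdist_mul. Qed.

Inductive chain (P : set K) (r : nat) (x : K) : K -> Prop :=
| chain_refl : P x -> chain P r x x
| chain_step y z : chain P r x y -> P z -> (wdist y z <= r)%N -> chain P r x z.

(** A set is 0-dimensional at scale [r] when its [r]-components have uniformly
bounded diameter; colorings below are partitions into such sets. *)
Definition components_bounded (r D : nat) (P : set K) : Prop :=
  forall x y, chain P r x y -> (wdist x y <= D)%N.

Lemma chain_end P r x y : chain P r x y -> P y.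
Proof. by case. Qed.

Lemma chain_start P r x y : chain P r x y -> P x.
Proof. by elim. Qed.

Lemma chain_trans P r y x z : chain P r x y -> chain P r y z -> chain P r x z.
Proof. by move=> xy; elim=> // a b _ xa Pb ab; exact: chain_step xa Pb ab. Qed.

Lemma chain_sym P r x y : chain P r x y -> chain P r y x.
Proof.
elim=> [Px|a b xa ax Pb ab]; first exact: chain_refl.
apply: chain_trans ax; apply: (chain_step (chain_refl _ Pb) (chain_end xa)).
by rewrite wdist_sym.
Qed.

Lemma sub_chain (P Q : set K) r s x y :
  P `<=` Q -> (r <= s)%N -> chain P r x y -> chain Q s x y.
Proof.
move=> PQ rs; elim=> [/PQ|a b _ xa /PQ Qb ab]; first exact: chain_refl.
by apply: chain_step xa Qb _; apply: leq_trans rs.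
Qed.

Lemma sub_components_bounded (P Q : set K) r D :
  P `<=` Q -> components_bounded r D Q -> components_bounded r D P.
Proof. by move=> PQ bQ x y /(sub_chain PQ (leqnn r)) /bQ. Qed.

(** A label that no [r]-step can change is constant on [r]-components, so they
may be bounded one label at a time. *)
Lemma components_bounded_label (L : Type) (l : K -> L) (P : set K) r D :
  (forall x y, P x -> P y -> (wdist x y <= r)%N -> l x = l y) ->
  (forall a, components_bounded r D [set x | P x /\ l x = a]) ->
  components_bounded r D P.
Proof.
move=> lP bP x y xy; apply: (bP (l x)).
elim: xy => [Px|a b Pxa xa Pb ab]; first exact: chain_refl.
apply: (chain_step xa _ ab); split=> //.
by have [Pa <-] := chain_end xa; apply/esym/lP.
Qed.

(** Diameters of [A]-components are absorbed by measuring [B] at a scale beyond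
them: along an [r]-chain in the union, two visits to [B] separated by a stretch
of [A] are at distance at most [D + 2r], hence lie in one component of [B] at
that scale, and the chain stays within [D + r] of this component. *)
Lemma components_bounded_union (A B : set K) r D E :
    components_bounded r D A -> components_bounded (D + r.*2) E B ->
  components_bounded r (E + (D + r).*2) (A `|` B).
Proof.
move=> bA bB x y xy.
(* b and c are the first and the last visit of the chain to B. *)
have : chain A r x y \/ exists b c, [/\ (wdist x b <= D + r)%N,
    chain B (D + r.*2) b c & y = c \/ exists2 a, (wdist c a <= r)%N & chain A r a y].
  elim: xy => [[Ax|Bx]|z {}y _ IHz [Ay|By] zy].
  - by left; exact: chain_refl.
  - by right; exists x, x; split; [rewrite wdistxx | exact: chain_refl | left].
  - case: IHz => [xz|[b [c [xb bc cz]]]]; first by left; exact: chain_step xz Ay zy.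
    right; exists b, c; split=> //; right; case: cz => [<-|[a ca az]].
      by exists y => //; exact: chain_refl.
    by exists a => //; exact: chain_step az Ay zy.
  - right; case: IHz => [/bA xz|[b [c [xb bc cz]]]].
      exists y, y; split; [|exact: chain_refl|by left].
      by have := wdist_triangle z x y; lia.
    exists b, y; split=> //; last by left.
    apply: chain_step bc By _; case: cz => [<-|[a ca /bA az]]; first lia.
    by have := wdist_triangle z c y; have := wdist_triangle a c z; lia.
case=> [/bA|[b [c [xb /bB bc cy]]]]; first lia.
have := wdist_triangle b x y; have := wdist_triangle c b y.
case: cy => [->|[a ca /bA ay]]; first by rewrite wdistxx; lia.
by have := wdist_triangle a c y; lia.
Qed.

Lemma components_bounded_translate (P : set K) r D g :
  components_bounded r D P -> components_bounded r D [set x | P (g^-1 * x)].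
Proof.
move=> bP x y xy; rewrite -(wdist_translate g); apply: bP.
elim: xy => [Px|a b _ xa Pb ab]; first exact: chain_refl.
by apply: chain_step xa Pb _; rewrite wdist_translate.
Qed.

Definition coloring (k r D : nat) (X : set K) (c : K -> nat) : Prop :=
  (forall x, X x -> (c x < k)%N) /\
  forall i, components_bounded r D [set x | X x /\ c x = i].

(** [colorable k X] is asdim X <= k - 1, phrased without covers: the colors are
the usual [k] families of uniformly bounded, [r]-disjoint sets. *)
Definition colorable (k : nat) (X : set K) : Prop :=
  forall r, exists D c, coloring k r D X c.

Lemma sub_colorable k (X Y : set K) : X `<=` Y -> colorable k Y -> colorable k X.
Proof.
move=> XY cY r; have [D [c [ck cD]]] := cY r; exists D, c; split=> [x /XY /ck //|i].
by apply: sub_components_bounded (cD i) => x [/XY].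
Qed.

Lemma colorable_widen j k (X : set K) : (j <= k)%N -> colorable j X -> colorable k X.
Proof.
move=> jk cX r; have [D [c [cj cD]]] := cX r; exists D, c; split=> // x /cj cx.
exact: leq_trans jk.
Qed.

Definition thickening (s : nat) (X : set K) : set K :=
  [set x | exists2 y, X y & (wdist x y <= s)%N].

Lemma colorable_thickening k s (X : set K) :
  colorable k X -> colorable k (thickening s X).
Proof.
move=> cX r; have [D [c [ck cD]]] := cX (r + s.*2)%N.
pose p x := xget x [set y | X y /\ (wdist x y <= s)%N].
have pP x : thickening s X x -> X (p x) /\ (wdist x (p x) <= s)%N.
  move=> [y Xy xy]; rewrite /p.
  by apply: (@xgetPex _ _ [set y | X y /\ (wdist x y <= s)%N]); exists y.
exists (D + s.*2)%N, (c \o p); split=> [x /pP [Xp _]|i x y xy]; first exact: ck.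
have : chain [set z | X z /\ c z = i] (r + s.*2) (p x) (p y).
  elim: xy => [[/pP[Xp _] ci]|a b xa xpa [/pP[Xb bp] ci] ab]; first exact: chain_refl.
  have [/pP[_ ap] _] := chain_end xa; apply: chain_step xpa _ _ => //.
  have := wdist_triangle a (p a) (p b); have := wdist_triangle b a (p b).
  by rewrite (wdist_sym (p a) a); lia.
move=> /cD; have [/pP[_ ap] _] := chain_start xy; have [/pP[_ bp] _] := chain_end xy.
have := wdist_triangle (p x) x y; have := wdist_triangle (p y) (p x) y.
by rewrite (wdist_sym (p y) y); lia.
Qed.

(** Coarse comparisons of word metrics reduce to finiteness of balls: any
function is bounded on a finite set, and so is any partial inverse of an
injection. *)
Lemma finite_ball r : exists L : seq K, forall x, (word_norm genS x <= r)%N -> x \in L.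
Proof.
elim: r => [|r [L LP]].
  exists [:: 1] => x; rewrite leqn0 => /eqP /word_norm_eq0 ->; exact: mem_head.
exists (L ++ [seq s * l | s <- S ++ map (@monoid.inv K) S, l <- L]) => x xr.
have [[|s w] [Sw szw ->]] := word_normP genS x.
  by rewrite mem_cat LP // big_nil word_norm1.
rewrite big_cons mem_cat; apply/orP; right.
have /andP[Ss Sw'] : ((s \in S) || (s^-1 \in S)) && is_word S w by [].
apply: allpairs_f; last first.
  by apply: LP; apply: leq_trans (word_norm_le genS Sw') _; rewrite /= in szw; lia.
rewrite mem_cat; case/orP: Ss => [->//|Ss]; apply/orP; right.
by rewrite -[s]invgK map_f.
Qed.

End WordDistance.

Arguments wdist_triangle {K S genS} y x z.

(** * Change of generating set and of ambient group *)

Lemma coarse_inverse (H K : groupType) (S : seq H) (T : seq K) (genS : generates S)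
    (genT : generates T) (f : H -> K) (r : nat) : injective f ->
  exists s, forall h, (word_norm genT (f h) <= r)%N -> (word_norm genS h <= s)%N.
Proof.
move=> f_inj; have [L LP] := finite_ball genT r.
have [s sP] : exists s, forall h, f h \in L -> (word_norm genS h <= s)%N.
  elim: L {LP} => [|k L [s sP]]; first by exists 0%N.
  have [[h0 h0k]|nk] := pselect (exists h0, f h0 = k).
    exists (maxn s (word_norm genS h0)) => h; rewrite inE => /predU1P[|/sP].
      by rewrite -h0k => /f_inj ->; rewrite leq_maxr.
    by rewrite leq_max => ->.
  exists s => h; rewrite inE => /predU1P[hk|/sP //].
  by case: nk; exists h.
by exists s => h /LP /sP.
Qed.

Lemma coarse_lipschitz (H K : groupType) (S : seq H) (T : seq K) (genS : generates S)
    (genT : generates T) (f : H -> K) (r : nat) :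
  exists s, forall h, (word_norm genS h <= r)%N -> (word_norm genT (f h) <= s)%N.
Proof.
have [L LP] := finite_ball genS r; exists (\max_(h <- L) word_norm genT (f h)).
by move=> h /LP hL; exact: leq_bigmax_seq.
Qed.

(** Coarse invariance. With [f] the identity it exchanges two generating sets;
with [f] an inclusion it compares the metric of a subgroup with the one induced
by the ambient group. *)
Lemma colorable_image (H K : groupType) (S : seq H) (T : seq K) (genS : generates S)
    (genT : generates T) (f : H -> K) (k : nat) (X : set H) :
    {morph f : x y / (x * y)%g} -> injective f ->
  colorable genS k X -> colorable genT k (f @` X).
Proof.
move=> fM f_inj cX r.
have f1 : f 1%g = 1%g by apply: (@mulgI _ (f 1%g)); rewrite -fM !mulg1.
have fd x y : ((f x)^-1 * f y = f (x^-1 * y))%g.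
  by apply: (@mulgI _ (f x)); rewrite mulVKg -fM mulVKg.
have [s sP] := coarse_inverse genS genT r f_inj.
have [D [c [ck cD]]] := cX s.
have [E EP] := coarse_lipschitz genS genT f D.
pose p y := xget 1%g [set x | X x /\ f x = y].
have pP y : (f @` X) y -> X (p y) /\ f (p y) = y.
  move=> [x Xx xy]; rewrite /p.
  by apply: (@xgetPex _ _ [set x | X x /\ f x = y]); exists x.
exists E, (c \o p); split=> [y /pP[Xp _]|i x y xy]; first exact: ck.
have : chain genS [set z | X z /\ c z = i] s (p x) (p y).
  elim: xy => [[/pP[Xp _] ci]|a b xa xpa [/pP[Xb bp] ci] ab]; first exact: chain_refl.
  have [/pP[_ ap] _] := chain_end xa; apply: chain_step xpa _ _ => //.
  by apply: sP; rewrite -fd ap bp.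
move=> /cD /EP; rewrite -fd.
have [/pP[_ ->] _] := chain_start xy; have [/pP[_ ->] _] := chain_end xy.
by [].
Qed.

(** * Asymptotic dimension and colorings *)

Section AsdimColorings.
Import Order.TTheory GRing.Theory Num.Theory.
Local Open Scope ring_scope.
Local Open Scope card_scope.
Variable R : realType.

(** From a cover to colors. Let [M x j] be the set of cover elements that meet
the ball of radius [(j + 1) r] about [x]. Its cardinal is nondecreasing in [j]
and, for [j <= n + 1], lies between 1 and [n + 1]; so it repeats at two
consecutive [j]. The repeated value is the color, the corresponding set of cover
elements is the label. If [x] and [y] are [r]-close and have the same color, with
the repetition at [j <= j'], then [M x j] is contained in [M y (j' + 1)], which
is [M y j'], and equality of cardinals makes the two labels equal. *)
Lemma asdim_le_families (X : metricType R) n (r : R) : asdim_le X n -> 0 < r ->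
  exists D (c : X -> nat) (l : X -> set (set X)),
    [/\ forall x, (c x < n.+1)%N,
        forall x y, mdist x y < r -> c x = c y -> l x = l y
      & forall x y, l x = l y -> mdist x y <= D].
Proof.
move=> Xn r0; have /Xn[U [covU [D UD] Ucard]] : 0 < n.+2%:R * r.
  by rewrite mulr_gt0 // ltr0n.
pose M x j := [set A | U A /\ A `&` ball x (j.+1%:R * r) !=set0].
pose m x j := #|` fset_set (M x j) |.
have subM x y i j : (i <= j)%N -> mdist x y <= (j - i)%:R * r -> M x i `<=` M y j.
  move=> ij xy A [UA [z [Az]]]; rewrite ballEmdist /= => xz; split=> //.
  exists z; split=> //; rewrite ballEmdist /=.
  have := metric_triangle y x z; rewrite (metric_sym y x).
  move: xy; rewrite natrB // -![_.+1%:R]natr1; nra.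
have finM x j : (j <= n.+1)%N -> finite_set (M x j) /\ (m x j <= n.+1)%N.
  move=> jn; have Mn : M x j #<= `I_n.+1.
    apply: card_le_trans (Ucard x); apply: subset_card_le.
    by apply: (subM x x j n.+1) => //; rewrite mdistxx mulr_ge0 ?ler0n ?ltW.
  have finMx : finite_set (M x j) by apply: card_le_finite Mn _; exact: finite_II.
  by split=> //; exact: geq_card_fset_set.
have m_homo x j : (j <= n)%N -> (m x j <= m x j.+1)%N.
  move=> jn; have [fj _] := finM x j (leqW jn); have [fj1 _] := finM x j.+1 jn.
  rewrite /m fsubset_leq_card // -fset_set_sub //; apply: subM => //.
  by rewrite mdistxx mulr_ge0 ?ler0n ?ltW.
have M_neq0 x j : exists A, M x j A.
  have : [set: X] x by [].
  rewrite -covU => -[A UA Ax]; exists A; split=> //; exists x; split=> //.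
  by rewrite ballEmdist /= mdistxx mulr_gt0 ?ltr0n.
have m_gt0 x j : (j <= n.+1)%N -> (0 < m x j)%N.
  move=> jn; have [fj _] := finM x j jn; rewrite lt0n; apply/negP => /eqP /cardfs0_eq.
  by move=> /(fset_set_set0 fj) M0; have [A] := M_neq0 x j; rewrite M0.
(* Strict growth at each of these n + 1 steps would exceed the bound n + 1. *)
have stable x : exists j, (j <= n)%N && (m x j == m x j.+1).
  apply: contrapT => nst.
  have : forall j, (j <= n.+1)%N -> (j < m x j)%N.
    elim=> [|j IHj] jn; first exact: m_gt0.
    apply: leq_ltn_trans (IHj (ltnW jn)) _; rewrite ltn_neqAle m_homo // andbT.
    by apply/negP => mj; apply: nst; exists j; rewrite mj -ltnS jn.
  by move=> /(_ n.+1 (leqnn _)); have [_] := finM x n.+1 (leqnn _); lia.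
pose J x := xchoose (stable x).
have JP x : (J x <= n)%N /\ m x (J x) = m x (J x).+1.
  by have /andP[? /eqP] := xchooseP (stable x).
clearbody J.
exists (2 * (n.+2%:R * r) + D), (fun x => (m x (J x)).-1), (fun x => M x (J x)).
split.
- move=> x; have [Jn _] := JP x; have [_] := finM x _ (leqW Jn).
  by have := m_gt0 x _ (leqW Jn); lia.
- suff wl x y : (J x <= J y)%N -> mdist x y < r -> (m x (J x)).-1 = (m y (J y)).-1 ->
      M x (J x) = M y (J y).
    move=> x y; case/orP: (leq_total (J x) (J y)) => Jxy xy mxy; first exact: wl.
    by rewrite metric_sym in xy; rewrite (wl y x Jxy xy (esym mxy)).
  move=> Jxy xy mxy.
  have [Jxn _] := JP x; have [Jyn mJy] := JP y.
  have [fx _] := finM x _ (leqW Jxn); have [fy _] := finM y _ (leqW Jyn).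
  have [fy1 _] := finM y (J y).+1 Jyn.
  have s1 : M x (J x) `<=` M y (J y).+1.
    apply: subM; first exact: leqW.
    by apply: le_trans (ltW xy) _; rewrite ler_peMl ?(ltW r0) // ler1n subn_gt0.
  have s2 : M y (J y) `<=` M y (J y).+1.
    by apply: subM => //; rewrite mdistxx mulr_ge0 ?ler0n ?ltW.
  have cards : m x (J x) = m y (J y).
    by have := m_gt0 x _ (leqW Jxn); have := m_gt0 y _ (leqW Jyn); lia.
  have e2 : fset_set (M y (J y)) = fset_set (M y (J y).+1).
    by apply/fsetP/fsubset_cardP => //; rewrite -fset_set_sub.
  have e1 : fset_set (M x (J x)) = fset_set (M y (J y).+1).
    apply/fsetP/fsubset_cardP; last by rewrite -fset_set_sub.
    by rewrite -/(m x _) cards mJy.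
  by rewrite -(fset_setK fx) e1 -e2 fset_setK.
- move=> x y lxy; have [A] := M_neq0 x (J x).
  have [Jxn _] := JP x; have [Jyn _] := JP y.
  have big j : (j <= n)%N -> j.+1%:R * r <= n.+2%:R * r.
    by move=> jn; rewrite ler_wpM2r ?ltW // ltr_nat; lia.
  move=> MA; have := MA; rewrite lxy => -[_ [b [Ab]]]; rewrite ballEmdist /= => yb.
  case: MA => UA [a [Aa]]; rewrite ballEmdist /= => xa.
  have := UD A UA a b Aa Ab; have := metric_triangle x a y.
  have := metric_triangle a b y.
  by rewrite (metric_sym b y); have := big _ Jxn; have := big _ Jyn; lra.
Qed.

Variables (G : groupType) (S : seq G) (genS : generates S).

(** The map [f] is an isometric embedding; taking it to be the inclusion of a
subset gives the subset its restricted metric. *)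
Lemma asdim_le_colorable (X : metricType R) (x0 : X) (f : X -> G) n :
    (forall x y, mdist x y = (wdist genS (f x) (f y))%:R) ->
  asdim_le X n -> colorable genS n.+1 (range f).
Proof.
move=> fd Xn r; have [|D [c [l [cn lr lD]]]] := asdim_le_families Xn (r := r.+1%:R).
  by rewrite ltr0n.
pose p y := xget x0 [set x | f x = y].
have pP y : range f y -> f (p y) = y.
  by move=> [x _ xy]; rewrite /p; apply: (@xgetPex _ _ [set x | f x = y]); exists x.
exists (Num.truncn D), (c \o p); split=> [y _|i x y xy]; first exact: cn.
have : l (p x) = l (p y).
  elim: xy => // a b xa -> [bX cb] ab; have [aX ca] := chain_end xa.
  by apply: lr; rewrite ?fd ?ltr_nat ?pP // [LHS]ca.
move=> /lD; have [xX _] := chain_start xy; have [yX _] := chain_end xy.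
rewrite fd !pP // => xyD; rewrite truncn_ge_nat //.
by apply: le_trans xyD; rewrite ler0n.
Qed.

(** The cover consists of the components of the color classes at scale [2r]: two
of them meeting a common [r]-ball have different colors. *)
Lemma colorable_asdim_le n : colorable genS n.+1 setT -> asdim_le (word_space R genS) n.
Proof.
move=> cG r r0; pose s := Num.truncn (2 * r); have [D [c [cn cD]]] := cG s.
pose comp x := chain genS [set y | [set: G] y /\ c y = c x] s x.
have compxx x : comp x x by exact: chain_refl.
exists (range comp : set (set (word_space R genS))); split.
- by apply/seteqP; split=> // x _; exists (comp x) => //; exists x.
- exists D%:R => _ [z _ <-] x y zx zy; rewrite mdist_word_space ler_nat.
  by apply: (cD (c z)); apply: chain_trans zy; exact: chain_sym.
- move=> x; set F := (X in X #<= _).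
  pose p (A : set G) := xget (1%g : G) (A `&` (ball (x : word_space R genS) r : set G)).
  have pP A : F A -> A (p A) /\ mdist (x : word_space R genS) (p A) < r.
    move=> [_ Ax]; have := xgetPex (1%g : G) Ax; rewrite -/(p A) => -[ApA].
    by rewrite ballEmdist.
  apply/card_subP; exists ((c \o p) @` F); last by move=> _ [A _ <-] /=; exact: cn.
  apply: inj_card_eq => A B /set_mem FA /set_mem FB /= cAB.
  have [ApA xA] := pP A FA; have [BpB xB] := pP B FB.
  have pAB : (wdist genS (p A) (p B) <= s)%N.
    have AB : mdist (p A : word_space R genS) (p B) <= 2 * r.
      apply: le_trans (metric_triangle _ (x : word_space R genS) _) _.
      by rewrite (metric_sym _ (x : word_space R genS)); lra.
    by rewrite /s truncn_ge_nat // mulr_ge0 // ltW.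
  case: FA FB => -[a _ aA] _ [[b _ bB] _].
  have apA : comp a (p A) by rewrite aA.
  have bpB : comp b (p B) by rewrite bB.
  have [_ ca] := chain_end apA; have [_ cb] := chain_end bpB.
  have cab : c b = c a by rewrite -cb -ca cAB.
  have ab : comp a b.
    apply: (chain_trans (chain_step apA _ pAB)).
      by split=> //; rewrite cb.
    by apply: chain_sym; rewrite /comp cab in bpB.
  rewrite -aA -bB; apply/seteqP; split=> z; rewrite /comp cab => az;
    last exact: chain_trans az.
  by apply: chain_trans az; exact: chain_sym.
Qed.

Lemma asdim_attained (X : metricType R) n0 : asdim_le X n0 ->
  exists2 n, asdim_le X n & asdim X = n%:R%:E.
Proof.
move=> Xn0; have ex_n : exists n, `[< asdim_le X n >] by exists n0; exact/asboolP.
have [n /asboolP Xn min_n] := ex_minnP ex_n; exists n => //.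
apply/eqP; rewrite eq_le; apply/andP; split.
  by apply: ereal_inf_lbound; exists n.
apply: le_ereal_inf_tmp => _ [m Xm <-]; rewrite lee_fin ler_nat.
by apply: min_n; apply/asboolP.
Qed.

Lemma asdim_pinfty (X : metricType R) : ~ (exists n, asdim_le X n) -> asdim X = +oo%E.
Proof.
move=> nX; rewrite /asdim [X in ereal_inf X](_ : _ = set0) ?ereal_inf0 //.
by apply/seteqP; split=> // x [n Xn _]; apply: nX; exists n.
Qed.

End AsdimColorings.

(** * Normal forms *)

Section NormalForms.
Local Open Scope group_scope.
Variables (G : groupType) (N : groupClosed G).
Variable phi : {multiplicative subgroup N -> G}.
Hypothesis phi_inj : injective phi.

Definition t_pow (e : bool) : HNN phi := hnn_class phi [:: inr e].

(** [slides e k k'] is the relation [k t^e = t^e k'] of the presentation, where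
[e = true] stands for the exponent -1, as in the letters of [hnn_word]. Treating
[phi] and its partial inverse as one family indexed by [e] makes every later
argument symmetric in the two exponents. *)
Definition slides (e : bool) (k k' : G) : Prop :=
  exists n : subgroup N,
    if e then k = val n /\ k' = phi n else k = phi n /\ k' = val n.

Definition slidable e k : Prop := exists k', slides e k k'.

Definition slide e k : G := xget 1 [set k' | slides e k k'].

(** The representative depends only on the coset of [g] because it is chosen from
a set that does. *)
Definition coset_rep e g : G := xget 1 [set a | slidable e (a^-1 * g)].

Lemma slidesN e k k' : slides (~~ e) k' k <-> slides e k k'.
Proof. by case: e; split=> -[n [? ?]]; exists n. Qed.

Lemma slidesM e k k' h h' :
  slides e k k' -> slides e h h' -> slides e (k * h) (k' * h').
Proof.
case: e => -[n [-> ->]] [m [-> ->]]; exists (n * m); split; by rewrite ?valM ?gmulfM.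
Qed.

Lemma phi1 : phi 1 = 1.
Proof. by apply: (@mulgI _ (phi 1)); rewrite -gmulfM !mulg1. Qed.

Lemma phiV n : phi n^-1 = (phi n)^-1.
Proof. by apply/esym/mulg1_eq; rewrite -gmulfM mulgV phi1. Qed.

Lemma slides1 e : slides e 1 1.
Proof. by exists 1; rewrite (val1 (subgroup N)) phi1; case: e. Qed.

Lemma slidesV e k k' : slides e k k' -> slides e k^-1 k'^-1.
Proof. by case: e => -[n [-> ->]]; exists n^-1; rewrite (gmulfV val) phiV. Qed.

Lemma slides_fun e k h h' : slides e k h -> slides e k h' -> h = h'.
Proof.
case: e => -[n [-> ->]] [m [nm ->]]; first by rewrite (val_inj nm).
by rewrite (phi_inj nm).
Qed.

Lemma slideE e k k' : slides e k k' -> slide e k = k'.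
Proof.
by move=> kk'; apply: (@slides_fun e k) => //;
  rewrite /slide; apply: xgetPex; exists k'.
Qed.

Lemma slideP e k : slidable e k -> slides e k (slide e k).
Proof. by move=> [k' kk']; rewrite (slideE kk'). Qed.

Lemma slidable_mulr e g k : slidable e k -> slidable e (g * k) <-> slidable e g.
Proof.
move=> [k' kk']; split=> -[h gh]; last by exists (h * k'); exact: slidesM.
by exists (h * k'^-1); rewrite -[g](mulgK k); exact: slidesM gh (slidesV kk').
Qed.

Lemma coset_repP e g : slidable e ((coset_rep e g)^-1 * g).
Proof.
rewrite /coset_rep; apply: (@xgetPex _ 1 [set a | slidable e (a^-1 * g)]).
by exists g; rewrite /= mulVg; exists 1; exact: slides1.
Qed.

Lemma coset_rep_mulr e g k : slidable e k -> coset_rep e (g * k) = coset_rep e g.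
Proof.
move=> k_sl; rewrite /coset_rep; congr xget; apply/seteqP; split=> a /=;
by rewrite mulgA => /(slidable_mulr _ k_sl).
Qed.

Lemma coset_rep_id e g : coset_rep e (coset_rep e g) = coset_rep e g.
Proof. by rewrite -(coset_rep_mulr _ (coset_repP e g)) mulVKg. Qed.

Lemma slidable_coset_rep e g : slidable e (coset_rep e g) <-> slidable e g.
Proof.
by rewrite -{2}(mulVKg (coset_rep e g) g); split=> /(slidable_mulr _ (coset_repP e g)).
Qed.

Lemma slides_t e k k' : slides e k k' ->
  hnn_in phi k * t_pow e = t_pow e * hnn_in phi k'.
Proof.
case: e => -[n [-> ->]]; rewrite -hnn_tJ.
  by rewrite /t_pow -hnn_tV !mulgA mulVg mul1g.
by rewrite mulgVK.
Qed.

Lemma t_powN e : t_pow e * t_pow (~~ e) = 1.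
Proof. by rewrite hnn_classM; apply/hnn_classP; exact: hnn_cancel. Qed.

Lemma t_powV e : t_pow (~~ e) * t_pow e = 1.
Proof. by have := t_powN (~~ e); rewrite negbK. Qed.

(** The pair [([:: (a_m, e_m); ... ; (a_1, e_1)], g)] stands for the product
[a_1 t^e_1 ... a_m t^e_m g]. The last syllable comes first, so that right
multiplication acts at the head of the list. *)
Definition normal_form : Type := seq (G * bool) * G.

(** Multiplication by [t^e]: split the final element as a representative times an
element that slides through [t^e]. *)
Definition push e (w : normal_form) : normal_form :=
  ((coset_rep e w.2, e) :: w.1, slide e ((coset_rep e w.2)^-1 * w.2)).

Definition ends_with_inverse e (l : seq (G * bool)) : bool :=
  if l is (_, d) :: _ then d == ~~ e else false.

Definition step (w : normal_form) (x : G + bool) : normal_form :=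
  match x, w.1 with
  | inl g, l => (l, w.2 * g)
  | inr e, (a, d) :: l =>
      if (d == ~~ e) && `[< slidable e w.2 >] then (l, a * slide e w.2) else push e w
  | inr e, [::] => push e w
  end.

Arguments step : simpl never.

Lemma step_inl w g : step w (inl g) = (w.1, w.2 * g).
Proof. by []. Qed.

Fixpoint reduced (l : seq (G * bool)) : Prop :=
  if l is (a, e) :: l' then
    [/\ coset_rep e a = a, ends_with_inverse e l' -> ~ slidable e a & reduced l']
  else True.

Lemma step_pop e a l h :
  slidable e h -> step ((a, ~~ e) :: l, h) (inr e) = (l, a * slide e h).
Proof. by move=> /asboolP he; rewrite /step /= eqxx he. Qed.

Lemma step_push e l h : (ends_with_inverse e l -> ~ slidable e h) ->
  step (l, h) (inr e) = push e (l, h).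
Proof.
case: l => [|[a d] l] //= nred; rewrite /step /=; case: eqP => //= de.
by case: asboolP => // he; case: nred => //; rewrite de eqxx.
Qed.

Lemma ends_with_inverseP e l h :
  (exists a l', l = (a, ~~ e) :: l' /\ slidable e h) \/
  (ends_with_inverse e l -> ~ slidable e h).
Proof.
case: l => [|[a d] l] /=; first by right.
have [->|] := eqVneq d (~~ e); last by right.
by have [he|he] := pselect (slidable e h); [left; exists a, l | right].
Qed.

Lemma reduced_step w x : reduced w.1 -> reduced (step w x).1.
Proof.
case: w x => [l h] [//|e] red_l.
have [[a [l' [le he]]]|nred] := ends_with_inverseP e l h.
  by move: red_l; rewrite le step_pop //= => -[].
rewrite step_push //=; split=> //; first exact: coset_rep_id.
by move=> /nred nh /slidable_coset_rep.
Qed.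

(** The defining relations at once: [k' = 1] gives the cancellation of [t^e] with
its inverse, and a general [k'] the conjugation relation. Reducedness enters when
[t^e] cancels the last syllable [(a, ~~ e)]: the following letter must then
create this same syllable again, not cancel a further one. *)
Lemma step_slide e k k' l h : reduced l -> slides e k k' ->
  step (step (step (l, h) (inr e)) (inl k')) (inr (~~ e)) = (l, h * k).
Proof.
move=> red_l kk'.
have k'k : slides (~~ e) k' k by apply/slidesN.
have [[a [l' [le he]]]|nred] := ends_with_inverseP e l h.
  move: red_l; rewrite le step_pop //= => -[ra nra _].
  have /slideP hs := he; have /slidesN sh := hs.
  have sk' : slides (~~ e) (slide e h * k') (h * k) by exact: slidesM.
  have sk'd : slidable (~~ e) (slide e h * k') by exists (h * k).
  rewrite step_inl /= -mulgA step_push.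
    by rewrite /push /= coset_rep_mulr // ra mulKg (slideE sk').
  by move=> /nra na /(slidable_mulr _ sk'd).
rewrite step_push //; set c := (coset_rep e h)^-1 * h.
have /slideP cs := coset_repP e h; have /slidesN sc := cs.
have sck : slides (~~ e) (slide e c * k') (c * k) by exact: slidesM.
rewrite step_inl /= -/c.
have := @step_pop (~~ e) (coset_rep e h) l (slide e c * k'); rewrite negbK => ->;
  last first.
  by exists (c * k).
by rewrite (slideE sck) /c !mulgA mulgV mul1g.
Qed.

Lemma reduced_steps w u : reduced w.1 -> reduced (foldl step w u).1.
Proof. by elim: u w => //= x u IHu w red_w; apply/IHu/reduced_step. Qed.

(** Letters act on reduced normal forms from the right, and this action factors
through the HNN-extension; this is what makes normal forms unique. *)
Lemma steps_hnn_eq u v : hnn_eq phi u v ->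
  forall w, reduced w.1 -> foldl step w u = foldl step w v.
Proof.
elim=> {u v} //.
- by move=> u v _ IH w /IH.
- by move=> u v w _ IHuv _ IHvw a red_a; rewrite IHuv // IHvw.
- move=> u u' v v' _ IHu _ IHv w red_w; rewrite !foldl_cat IHu // IHv //.
  exact: reduced_steps.
- by move=> [l h] _; rewrite /= step_inl mulg1.
- by move=> g h [l k] _; rewrite /= !step_inl mulgA.
- move=> e [l h] red_l; have := step_slide h red_l (slides1 e).
  by rewrite step_inl !mulg1 -surjective_pairing.
- move=> n [l h] red_l; rewrite /= (step_slide (e := false) (k := phi n)) ?step_inl //.
  by exists n.
Qed.

Definition nf (x : HNN phi) : normal_form := foldl step ([::], 1) (repr x : hnn_word G).

Lemma nf_class u : nf (hnn_class phi u) = foldl step ([::], 1) u.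
Proof. by apply: steps_hnn_eq => //; exact: hnn_repr_class. Qed.

Lemma nf_mul x u : nf (x * hnn_class phi u) = foldl step (nf x) u.
Proof. by rewrite -{1}(hnn_class_repr x) hnn_classM nf_class foldl_cat. Qed.

Fixpoint path_elt (l : seq (G * bool)) : HNN phi :=
  if l is (a, e) :: l' then path_elt l' * hnn_in phi a * t_pow e else 1.

Definition nf_elt (w : normal_form) : HNN phi := path_elt w.1 * hnn_in phi w.2.

Lemma nf_elt_push e w : nf_elt (push e w) = nf_elt w * t_pow e.
Proof.
rewrite /nf_elt /= -mulgA -(slides_t (slideP (coset_repP e w.2))) !mulgA.
by rewrite -(mulgA (path_elt _)) -hnn_inM mulVKg.
Qed.

Lemma nf_elt_step w x : nf_elt (step w x) = nf_elt w * hnn_class phi [:: x].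
Proof.
case: w x => [l h] [g|e]; first by rewrite step_inl /nf_elt /= hnn_inM mulgA.
rewrite -/(t_pow e).
have [[a [l' [-> he]]]|nred] := ends_with_inverseP e l h; last first.
  by rewrite step_push // nf_elt_push.
rewrite step_pop // /nf_elt /= hnn_inM -!mulgA (slides_t (slideP he)).
by rewrite (mulgA (t_pow _)) t_powV mul1g.
Qed.

Lemma nfK x : nf_elt (nf x) = x.
Proof.
rewrite -[in RHS](hnn_class_repr x) /nf.
elim/last_ind: (repr x : hnn_word G) => [|u a IHu].
  by rewrite /nf_elt /= mul1g hnn_in1.
by rewrite -cats1 foldl_cat /= nf_elt_step IHu hnn_classM.
Qed.

(** The vertex [x G] of the Bass-Serre tree, encoded by its normal form: [vertex]
is constant on left cosets of [G], and the parent of a vertex is its [behead].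
Thus [suffix w (vertex x)] says that [x] lies over the subtree rooted at [w]. *)
Definition vertex (x : HNN phi) : seq (G * bool) := (nf x).1.

Lemma nf_in g : nf (hnn_in phi g) = ([::], g).
Proof. by rewrite nf_class /= step_inl mul1g. Qed.

(** Britton's lemma for elements of the base group. *)
Lemma hnn_in_inj : injective (hnn_in phi).
Proof. by move=> g h /(congr1 nf); rewrite !nf_in => -[]. Qed.

Lemma vertex_mul_in x g : vertex (x * hnn_in phi g) = vertex x.
Proof. by rewrite /vertex nf_mul. Qed.

Lemma vertex_elt x : exists g, x = path_elt (vertex x) * hnn_in phi g.
Proof. by exists (nf x).2; rewrite -[LHS]nfK. Qed.

(** The edge from [l] to its parent corresponds to a left coset of [N], of which
this is a point. For [e = true] the coset lies on the side of the parent. *)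
Definition edge_base (l : seq (G * bool)) : HNN phi :=
  if l is (a, e) :: l' then
    path_elt l' * hnn_in phi a * (if e then 1 else t_pow e)
  else 1.

(** Adjacency in the tree: multiplication by [t^e] moves to the parent or to a
child. In the second case the element reached lies within one letter of the coset
of [N] attached to the edge that was crossed. *)
Lemma vertex_mul_t x e :
  (exists a, vertex x = (a, ~~ e) :: vertex (x * t_pow e)) \/
  (exists a n, [/\ vertex (x * t_pow e) = (a, e) :: vertex x, n \in N
    & x * t_pow e =
      edge_base (vertex (x * t_pow e)) * hnn_in phi n * (if e then t_pow e else 1)]).
Proof.
rewrite -{3}(nfK (x * _)) /vertex nf_mul /=; case: (nf x) => [l h].
have [[a [l' [-> he]]]|nred] := ends_with_inverseP e l h.
  by left; exists a; rewrite step_pop.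
right; rewrite step_push // /push /=; set c := _^-1 * h; exists (coset_rep e h).
have /slideP cs : slidable e c := coset_repP e h; rewrite /nf_elt /=.
have [n cn] := cs; exists (if e then c else slide e c); split=> //.
  by case: (e) cn => -[cn scn]; rewrite (cn, scn); exact: valP.
by rewrite -mulgA -(slides_t cs) mulgA; case: (e) cs => cs;
  rewrite ?mulg1 // -!mulgA (slides_t cs).
Qed.

Lemma size_vertex_path l g : size (vertex (path_elt l * hnn_in phi g)) <= size l.
Proof.
elim: l g => [|[a e] l IHl] g; first by rewrite /= mul1g /vertex nf_in.
rewrite vertex_mul_in /=; have := IHl a.
have [[b ->]|[b [n [-> _ _]]]] := vertex_mul_t (path_elt l * hnn_in phi a) e;
  move=> /= ?; lia.
Qed.

Lemma path_elt_cat l l' : path_elt (l ++ l') = path_elt l' * path_elt l.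
Proof. by elim: l => [|[a e] l IHl] /=; rewrite ?mulg1 // IHl !mulgA. Qed.

(** Left translation by [path_elt w] carries the subtree at the root onto the one
at [w], so depth below [w] can be measured from the root. *)
Lemma size_vertex_translate x l w : vertex x = l ++ w ->
  size (vertex ((path_elt w)^-1 * x)) <= size l.
Proof.
have [g {2}->] := vertex_elt x => ->.
by rewrite path_elt_cat -!mulgA mulKg size_vertex_path.
Qed.

End NormalForms.

(** * The Bass-Serre tree *)

Lemma suffix_cons_or (A : eqType) (w l : seq A) a :
  suffix w (a :: l) -> w = a :: l \/ suffix w l.
Proof.
case/suffixP=> -[|b u] /= aluw; first by left.
by case: aluw => _ ->; right; exact: suffix_suffix.
Qed.

Section TreeColoring.
Local Open Scope group_scope.
Variables (G : groupType) (N : groupClosed G).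
Variable phi : {multiplicative subgroup N -> G}.
Hypothesis phi_inj : injective phi.
Variables (S : seq G) (genS : generates S).

Local Notation genH := (@generates_HNN G N phi S genS).
Local Notation letters := (rcons (map (hnn_in phi) S) (hnn_t phi)).
Local Notation d := (wdist genH).

Lemma is_word_letter (s : HNN phi) : is_word letters [:: s] ->
  (exists g, s = hnn_in phi g) \/ (exists e, s = t_pow phi e).
Proof.
rewrite /is_word /= andbT !mem_rcons !inE -orbA.
case/or4P=> [/eqP ->|/mapP[g _ ->]|/eqP st|/mapP[g _ sg]].
- by right; exists false.
- by left; exists g.
- by right; exists true; rewrite -[s]invgK st hnn_tV.
- by left; exists g^-1; rewrite -[s]invgK sg gmulfV.
Qed.

Lemma wdist_letter (x s : HNN phi) :
  is_word letters [:: s] -> (d x (x * s) <= 1)%N.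
Proof. by move=> /(word_norm_le genH); rewrite big_seq1 /wdist mulKg. Qed.

Lemma is_word_t e : is_word letters [:: t_pow phi e].
Proof.
rewrite /is_word /= andbT !mem_rcons !inE; case: e; last by rewrite eqxx.
by rewrite /t_pow -hnn_tV invgK eqxx !orbT.
Qed.

Lemma word_ind (P : HNN phi -> HNN phi -> nat -> Prop) :
    (forall x : HNN phi, P x x 0%N) ->
    (forall (x y s : HNN phi) m, is_word letters [:: s] ->
       P (x * s) y m -> P x y m.+1) ->
  forall x y : HNN phi, P x y (d x y).
Proof.
move=> P0 PS x y; have [w [Sw szw xy]] := word_normP genH (x^-1 * y).
rewrite /wdist -szw -[y](mulVKg x) xy; elim: w x Sw {szw xy} => [|s w IHw] x.
  by rewrite big_nil mulg1.
rewrite -cat1s /is_word all_cat => /andP[Ss Sw]; rewrite big_cons mulgA.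
by apply: (PS _ _ _ _ Ss); exact: IHw.
Qed.

Lemma size_vertex_lipschitz (x y : HNN phi) :
  (size (vertex x) <= size (vertex y) + d x y)%N.
Proof.
pose P (x y : HNN phi) m := (size (vertex x) <= size (vertex y) + m)%N.
apply: (word_ind (P := P)) => [{}x|{}x {}y s m]; rewrite /P.
  by rewrite addn0.
move=> /is_word_letter[[g ->]|[e ->]]; 
  first by rewrite (vertex_mul_in phi_inj) addnS => /leqW.
have [[a ->]|[a [k [-> _ _]]]] := vertex_mul_t phi_inj x e; rewrite addnS //.
by move=> /ltnW/leqW.
Qed.

Definition entrance (w : seq (G * bool)) (z : HNN phi) : Prop :=
  vertex z = w /\ exists2 k, k \in N & (d z (edge_base phi w * hnn_in phi k) <= 1)%N.

(** The tree property: the only edge leaving the subtree at [w] joins [w] to its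
parent, so a path that leaves this subtree goes through a point of the entrance
at [w] and next through a point over the parent. *)
Lemma subtree_exit (x y : HNN phi) (w : seq (G * bool)) :
    suffix w (vertex x) -> ~~ suffix w (vertex y) ->
  exists z z', [/\ entrance w z, vertex z' = behead w,
    (d x z <= d x y)%N & (d x z' <= d x y)%N].
Proof.
pose P (x y : HNN phi) (m : nat) : Prop :=
  suffix w (vertex x) -> ~~ suffix w (vertex y) ->
  exists z z', [/\ entrance w z, vertex z' = behead w,
    (d x z <= m)%N & (d x z' <= m)%N].
suff: P x y (d x y) by [].
apply: word_ind => [{}x -> //|{}x {}y s m Ss IH wx wy].
have xs := wdist_letter x Ss.
have [wxs|wxs] := boolP (suffix w (vertex (x * s))).
  have [z [z' [ez z'w xz xz']]] := IH wxs wy; exists z, z'; split=> //.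
      exact: (wdist_leD xs xz).
    exact: (wdist_leD xs xz').
move: Ss xs wx wxs => /is_word_letter[[g ->]|[e ->]].
  by rewrite (vertex_mul_in phi_inj) => _ ->.
have [[a xa]|[a [k [-> _ _]]]] := vertex_mul_t phi_inj x e => xs wx wxs; last first.
  by case/negP: wxs; exact: suffix_trans wx (suffix_cons _ _).
have vx : vertex x = w.
  by move: wx; rewrite xa => /suffix_cons_or[->|] //; rewrite (negPf wxs).
exists x, (x * t_pow phi e); split; last 3 first.
- by rewrite -vx xa.
- by rewrite wdistxx.
- exact: leq_trans xs _.
split=> //; have := vertex_mul_t phi_inj (x * t_pow phi e) (~~ e).
rewrite -mulgA t_powN mulg1 negbK vx => -[[b]|[b [k [_ Nk xk]]]].
  by rewrite -vx xa => /(congr1 size) /=; lia.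
exists k => //; rewrite {1}xk wdist_sym; case: (~~ e); last by rewrite mulg1 wdistxx.
by apply: wdist_letter; exact: is_word_t.
Qed.

(** [deep w C x] says that the distance from [x] to the complement of the subtree
at [w] exceeds [C]. Working with this distance makes everything below
1-Lipschitz. *)
Definition deep (w : seq (G * bool)) (C : nat) (x : HNN phi) : Prop :=
  forall y, (d x y <= C)%N -> suffix w (vertex y).

Lemma deep_suffix w C x : deep w C x -> suffix w (vertex x).
Proof. by apply; rewrite wdistxx. Qed.

Lemma deep_le w B C x : (B <= C)%N -> deep w C x -> deep w B x.
Proof. by move=> BC wx y xy; apply: wx; exact: leq_trans BC. Qed.

Lemma deep_step w B r x y : deep w (B + r) x -> (d x y <= r)%N -> deep w B y.
Proof.
by move=> wx xy z yz; apply: wx; rewrite addnC; exact: wdist_leD xy yz.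
Qed.

Lemma deep_of_size (w : seq (G * bool)) C x :
    suffix w (vertex x) -> (size w + C <= size (vertex x))%N ->
  deep w C x.
Proof.
move=> wx sz y xy; apply: contrapT => /negP wy.
have [z [z' [[zw _] z'w _ xz']]] := subtree_exit wx wy.
have := size_vertex_lipschitz x z'; rewrite z'w size_behead.
case: w wx sz wy zw z'w => [|a w] wx sz wy _ _ /=; first by rewrite suffix0s in wy.
by rewrite /= in sz; lia.
Qed.

(** A point of the subtree at [w] that is close to the complement is close to a
single coset of [N]; this is where the dimension of [N] comes in. *)
Lemma shallow_near_edge (w : seq (G * bool)) C x :
    suffix w (vertex x) -> ~ deep w C x ->
  thickening genH C.+1 (hnn_in phi @` [set k | k \in N])
    ((edge_base phi w)^-1 * x).
Proof.
move=> wx /existsNP[y /not_implyP[xy /negP wy]].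
have [z [_ [[_ [k Nk zk]] _ xz _]]] := subtree_exit wx wy.
exists (hnn_in phi k); first by exists k.
rewrite -(wdist_mul genH (edge_base phi w)) mulVKg -addn1.
by apply: wdist_leD zk; exact: leq_trans xz xy.
Qed.

Definition level_ball (m : nat) : set (HNN phi) := [set x | (size (vertex x) <= m)%N].

(** The part of the group over a ball of the tree has the dimension of [G], with no
contribution from [N]. Passing from radius [m] to [m + 1], the points at distance
more than [r] from the part already treated fall into distinct cosets of [G] that
are [r]-disjoint, since a path between two of them descends to level [m]. Their
bound [D] is uniform, so the union lemma applies with the part near level [m]
colored at a scale beyond [D]. *)
Lemma colorable_level_ball n m :
  colorable genH n (range (hnn_in phi)) -> colorable genH n (level_ball m).
Proof.
move=> cG; elim: m => [|m IHm].
  apply: sub_colorable cG => x; rewrite /level_ball /= leqn0 size_eq0 => /eqP vx.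
  by have [g ->] := vertex_elt phi_inj x; exists g => //; rewrite vx /= mul1g.
move=> r; have [D [c [cn cD]]] := cG r.
have [E [b [bn bE]]] := colorable_thickening r IHm (D + r.*2)%N.
pose near := thickening genH r (level_ball m).
pose far := level_ball m.+1 `\` near.
pose a x := c ((path_elt phi (vertex x))^-1 * x).
have far_vertex x y : far x -> far y -> (d x y <= r)%N -> vertex x = vertex y.
  move=> [xm xnear] [ym ynear] xy.
  have big z : level_ball m.+1 z -> ~ near z -> size (vertex z) = m.+1.
    rewrite /level_ball /= => zm znear; apply/eqP; rewrite eqn_leq zm ltnNge.
    by apply/negP => zm'; apply: znear; exists z; rewrite ?wdistxx.
  apply: contrapT => nxy; apply: (xnear).
  have [|z [z' [_ z'w _ xz']]] := subtree_exit (suffix_refl (vertex x)) (y := y).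
    have sxy : size (vertex y) = size (vertex x) by rewrite (big x) // (big y).
    by apply: contra_notN nxy; rewrite suffixE sxy subnn drop0 => /eqP.
  exists z'; last exact: leq_trans xz' xy.
  by rewrite /level_ball /= z'w size_behead (big x).
exists (E + (D + r).*2)%N, (fun x => if `[< near x >] then b x else a x).
split=> [x xm|i].
  case: asboolP => [/bn //|xfar]; apply: cn.
  by have [g {2}->] := vertex_elt phi_inj x; exists g => //; rewrite mulKg.
apply: (sub_components_bounded
  (Q := [set x | far x /\ a x = i] `|` [set x | near x /\ b x = i])).
  by move=> x [xm]; case: asboolP => ? ?; [right | left].
apply: components_bounded_union (bE i).
apply: (components_bounded_label (l := @vertex _ _ phi)) => [x y|w].
  by move=> [fx _] [fy _]; exact: far_vertex.
apply: sub_components_bounded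
  (components_bounded_translate (g := path_elt phi w) (cD i)).
move=> x [[_ ax] xw]; rewrite /= -xw; split=> //.
by have [g {2}->] := vertex_elt phi_inj x; exists g => //; rewrite mulKg.
Qed.

(** * Shells and layers *)

Variables n r : nat.

(** Larger than the depth of a shell, so that a shell never reaches the next
marked vertex. *)
Definition gap : nat := (n.+2 * r).+1.

Definition marked (w : seq (G * bool)) : bool := gap %| size w.

Definition shell (w : seq (G * bool)) (x : HNN phi) : Prop :=
  [/\ marked w, deep w r x & ~ deep w (n.+2 * r) x].

Definition in_shell (x : HNN phi) : Prop := exists w, shell w x.

Definition shell_index (x : HNN phi) : seq (G * bool) := xget [::] [set w | shell w x].

Lemma shell_indexP x : in_shell x -> shell (shell_index x) x.
Proof. by move=> [w xw]; apply: (@xgetPex _ _ [set w | shell w x]); exists w. Qed.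

(** Lying over a deeper marked vertex puts a point at depth at least [gap] below
[w]. *)
Lemma marked_size_le (w w' : seq (G * bool)) (x : HNN phi) : marked w -> marked w' ->
    suffix w (vertex x) -> suffix w' (vertex x) -> ~ deep w (n.+2 * r) x ->
  (size w' <= size w)%N.
Proof.
move=> mw mw' wx w'x ndeep; rewrite leqNgt; apply/negP => ww'; apply: ndeep.
apply: deep_of_size => //; apply: leq_trans (size_suffix w'x).
move: mw mw' ww'; rewrite /marked => /dvdnP[a ->] /dvdnP[b ->].
rewrite ltn_mul2r => /andP[_ ab]; apply: leq_trans (leq_mul ab (leqnn gap)).
by rewrite [leqRHS]mulSn [leqRHS]addnC leq_add2l leqnSn.
Qed.

(** Shells are [r]-disjoint: being deeper than [r] keeps an [r]-step inside the
subtree, and the gap excludes a nested shell. *)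
Lemma shell_step (w w' : seq (G * bool)) (x y : HNN phi) :
  shell w x -> shell w' y -> (d x y <= r)%N -> w = w'.
Proof.
move=> [mw wx nwx] [mw' w'y nw'y] xy.
have yx : (d y x <= r)%N by rewrite wdist_sym.
have w'x : suffix w' (vertex x) by exact: w'y.
have wy : suffix w (vertex y) by exact: wx.
have wx' := deep_suffix wx; have w'y' := deep_suffix w'y.
have sz : size w = size w'.
  apply/eqP; rewrite eqn_leq (marked_size_le mw' mw w'y') //.
  by rewrite (marked_size_le mw mw' wx').
by move: wx' w'x; rewrite !suffixE sz => /eqP wE /eqP w'E; exact: etrans (esym wE) w'E.
Qed.

Lemma shell_indexE w x : shell w x -> shell_index x = w.
Proof.
move=> xw; apply/esym/(shell_step xw (y := x)); last by rewrite wdistxx.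
by apply: shell_indexP; exists w.
Qed.

(** A shell has [n + 1] layers of thickness [r], so that an [r]-step cannot jump
over a layer. *)
Definition layer (x : HNN phi) : nat :=
  xget 0%N [set k | [/\ (k <= n)%N, deep (shell_index x) (k.+1 * r) x
                      & ~ deep (shell_index x) (k.+2 * r) x]].

Lemma layerP x : in_shell x -> [/\ (layer x <= n)%N,
  deep (shell_index x) ((layer x).+1 * r) x
  & ~ deep (shell_index x) ((layer x).+2 * r) x].
Proof.
move=> /shell_indexP [_]; rewrite -{1}[r]mul1n; set w := shell_index x => wx nwx.
rewrite /layer -/w; set P := [set k | _]; apply: (@xgetPex _ _ P).
have ex_k : exists k, `[< ~ deep w (k.+2 * r) x >] by exists n; exact/asboolP.
have [k /asboolP nk kmin] := ex_minnP ex_k; exists k; split=> //.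
  by apply: kmin; exact/asboolP.
case: k nk kmin => [//|k] nk kmin; apply: contrapT => nk'.
by have := kmin k; rewrite ltnn; case: asboolP => // _ /(_ isT).
Qed.

Lemma layer_deep x k : in_shell x -> (k <= layer x)%N ->
  deep (shell_index x) (k.+1 * r) x.
Proof. by move=> /layerP[_ + _] kx; apply: deep_le; rewrite leq_mul. Qed.

Lemma layer_shallow x k : in_shell x -> (layer x <= k)%N ->
  ~ deep (shell_index x) (k.+2 * r) x.
Proof.
move=> /layerP[_ _ +] kx; apply: contra_not.
by apply: deep_le; rewrite leq_mul.
Qed.

Lemma layerE w x k : marked w -> (k <= n)%N ->
    deep w (k.+1 * r) x -> ~ deep w (k.+2 * r) x ->
  shell w x /\ layer x = k.
Proof.
move=> mw kn wx nwx; have xw : shell w x.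
  split=> //; first by apply: deep_le wx; rewrite mulSn leq_addr.
  by apply: contra_not nwx; apply: deep_le; rewrite leq_mul.
split=> //; have ix : in_shell x by exists w.
have wE := shell_indexE xw; case: (ltngtP (layer x) k) => // kx; exfalso.
- case: k kx wx {kn nwx} => // k kx; rewrite -wE; exact: (layer_shallow (k := k)).
- by apply: nwx; rewrite -wE; exact: (layer_deep (k := k.+1)).
Qed.

(** The layers of index [i] cut the group into regions; a region is named by the
set of marked vertices above whose layer [i] a point lies. *)
Definition region (i : nat) (x : HNN phi) : set (seq (G * bool)) :=
  [set w | marked w /\ deep w (i.+2 * r) x].

Definition core (x : HNN phi) : set (seq (G * bool)) :=
  [set w | marked w /\ deep w r x].

Lemma region_core i x : (i <= n)%N -> ~ in_shell x -> region i x = core x.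
Proof.
move=> i_n nx; apply/seteqP; split=> w [mw wx]; split=> //.
  by apply: deep_le wx; rewrite mulSn leq_addr.
have : deep w (n.+2 * r) x by apply: contrapT => nwx; apply: nx; exists w.
by apply: deep_le; rewrite leq_mul.
Qed.

(** A region is bounded in the tree direction: if [w0] is the deepest vertex in its
name, a point of the region lies over the subtree at [w0], and it cannot be much
farther than the next marked vertex without this vertex belonging to the name. *)
Lemma region_level_ball (Q : set (seq (G * bool))) : exists g : HNN phi,
  forall i (x : HNN phi), (i <= n)%N -> region i x = Q ->
    level_ball (gap + n.+2 * r) (g^-1 * x).
Proof.
have [[x0 [i0 x0Q]]|nQ] := pselect (exists x i, region i x = Q); last first.
  by exists 1 => i x _ xQ; case: nQ; exists x, i.
pose P j := `[< exists2 w, Q w & size w = j >].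
have P0 : exists j, P j.
  exists 0%N; apply/asboolP; exists [::] => //; rewrite -x0Q; split; first exact: dvdn0.
  by move=> y _; exact: suffix0s.
have Pmax j : P j -> (j <= size (vertex x0))%N.
  move=> /asboolP[w]; rewrite -x0Q => -[_ /deep_suffix wx0] <-; exact: size_suffix.
have [_ /asboolP[w0 Qw0 <-] w0max] := ex_maxnP P0 Pmax.
exists (path_elt phi w0) => i x i_n xQ.
have [mw0 dw0] : region i x w0 by rewrite xQ.
have [l xl] : exists l : seq (G * bool), vertex x = l ++ w0.
  by have /suffixP := deep_suffix dw0.
apply: leq_trans (size_vertex_translate phi_inj xl) _.
rewrite leqNgt; apply/negP => lbig.
have gl : (gap <= size l)%N by apply: leq_trans (ltnW lbig); exact: leq_addr.
pose w := drop (size l - gap) (vertex x).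
have szw : size w = (gap + size w0)%N by rewrite size_drop xl size_cat; lia.
have Qw : Q w.
  rewrite -xQ; split; first by rewrite /marked szw dvdn_addr.
  apply: deep_of_size => //; first exact: suffix_drop.
  have ir : (i.+2 * r <= n.+2 * r)%N by rewrite leq_mul.
  by rewrite szw xl size_cat; lia.
have : (size w <= size w0)%N by apply: w0max; apply/asboolP; exists w.
by rewrite szw /gap; lia.
Qed.

(** The union of the shells has [n] colors [v] because it lies near cosets of
[N]. In layer [k] the color [v] is replaced by [bump k v], which uses all of the
[n + 1] colors except [k]. A chain of color [i] is thus never in a layer of index
[i], hence cannot change its region. Within a region, the shell points of color
[i] lie above layer [i], where [v = i], or below it, where [v = i - 1]; in both
cases they form components of bound [D0], which does not depend on the pieces
outside the shells. These pieces lie over balls of the tree and may be colored at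
a scale beyond [D0]. *)
Theorem coloring_HNN : colorable genH n.+1 (range (hnn_in phi)) ->
    colorable genH n (hnn_in phi @` [set k | k \in N]) ->
  exists D c, coloring genH n.+1 r D [set: HNN phi] c.
Proof.
move=> cG cN.
have [D0 [v0 [v0n v0D]]] := colorable_thickening (n.+2 * r).+1 cN r.
have [E [c0 [c0n c0E]]] := colorable_level_ball (gap + n.+2 * r) cG (D0 + r.*2)%N.
have /choice[g gP] := region_level_ball.
pose v x := v0 ((edge_base phi (shell_index x))^-1 * x).
have vn x : in_shell x -> (v x < n)%N.
  move=> /shell_indexP[_ wx nwx]; apply: v0n.
  by apply: shallow_near_edge => //; exact: deep_suffix wx.
have vD j : components_bounded genH r D0 [set x | in_shell x /\ v x = j].
  apply: (components_bounded_label (l := shell_index)) => [x y|w].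
    by move=> [/shell_indexP sx _] [/shell_indexP sy _]; exact: shell_step.
  apply: sub_components_bounded
    (components_bounded_translate (g := edge_base phi w) (v0D j)).
  move=> x [[/shell_indexP sx vx] xw]; rewrite /= -xw; split=> //.
  by case: sx => _ /deep_suffix wx; exact: shallow_near_edge.
pose c x := if `[< in_shell x >] then bump (layer x) (v x)
            else c0 ((g (core x))^-1 * x).
have cn x : (c x < n.+1)%N.
  rewrite /c; case: asboolP => [/vn vx|nx].
    apply: leq_ltn_trans (_ : (v x).+1 < n.+1)%N => //.
    by rewrite /bump -add1n leq_add2r leq_b1.
  by apply: c0n; apply: (gP _ 0%N) => //; exact: region_core.
exists (E + (D0 + r).*2)%N, c; split=> // i.
(* Colors above n do not occur. *)
have [i_n|n_i] := leqP i n; last first.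
  by move=> x y /chain_start[_ cx]; have := cn x; rewrite cx ltnS leqNgt n_i.
have no_block x w : c x = i -> marked w -> deep w (i.+1 * r) x -> deep w (i.+2 * r) x.
  move=> cx mw wx; apply: contrapT => nwx.
  have [xw lx] := layerE mw i_n wx nwx; have ix : in_shell x by exists w.
  move: cx; rewrite /c (asboolT ix) lx => /eqP.
  by rewrite eq_sym (negPf (neq_bump _ _)).
have sub_region x y : c y = i -> (d x y <= r)%N -> region i x `<=` region i y.
  move=> cy xy w [mw wx]; split=> //; apply: no_block => //.
  by apply: deep_step xy; rewrite addnC -mulSn.
apply: (components_bounded_label (l := region i)) => [x y [_ cx] [_ cy] xy|Q].
  by apply/seteqP; split; apply: sub_region => //; rewrite wdist_sym.
pose A := [set x | [/\ in_shell x, c x = i & region i x = Q]].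
pose B := [set x | level_ball (gap + n.+2 * r) ((g Q)^-1 * x) /\ c0 ((g Q)^-1 * x) = i].
apply: (sub_components_bounded (Q := A `|` B)).
  move=> x [[_ cx] xQ]; have [ix|nx] := pselect (in_shell x); first by left.
  right; split; first exact: gP i_n xQ.
  by move: cx; rewrite /c (asboolF nx) -(region_core i_n nx) xQ.
apply: components_bounded_union (components_bounded_translate (c0E i)).
have layer_region x : A x -> (layer x < i)%N = `[< ~ Q (shell_index x) >].
  move=> [ix cx <-]; have [mw _ _] := shell_indexP ix.
  have [xi|ix'|xi] := ltngtP (layer x) i; apply/esym.
  - by apply/asboolP => -[_]; apply: layer_shallow => //; exact: ltnW.
  - by apply/asboolPn; apply; split=> //; exact: (layer_deep (k := i.+1)).
  - move: cx; rewrite /c (asboolT ix) xi => /eqP.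
    by rewrite eq_sym (negPf (neq_bump _ _)).
apply: (components_bounded_label (l := fun x => (layer x < i)%N)) => [x y Ax Ay xy|b].
  rewrite !layer_region //; suff -> : shell_index x = shell_index y by [].
  case: Ax => /shell_indexP sx _ _; case: Ay => /shell_indexP sy _ _.
  exact: shell_step sx sy xy.
(* Solve bump k v = i for v: below layer i, that is for k < i, v = i - 1. *)
apply: sub_components_bounded (vD (i - b)%N) => x [[ix cx _] <-]; split=> //.
move: cx; rewrite /c (asboolT ix) => cx.
by have := bumpK (layer x) (v x); rewrite cx => <-.
Qed.
End TreeColoring.

(** * The inequality *)

Local Open Scope ereal_scope.

Lemma colorable_HNN (G : groupType) (S : seq G) (genS : generates S)
    (N : groupClosed G) (phi : {multiplicative subgroup N -> G})
    (phi_inj : injective phi) (T : seq (HNN phi)) (genT : generates T) n :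
    colorable genS n.+1 [set: G] -> colorable genS n [set g | g \in N] ->
  colorable genT n.+1 [set: HNN phi].
Proof.
move=> cG cN; pose genH := @generates_HNN G N phi S genS.
have in_inj := hnn_in_inj phi_inj.
have cH : colorable genH n.+1 [set: HNN phi].
  have inM : {morph hnn_in phi : g h / (g * h)%g} := @hnn_inM _ _ phi.
  have cG' := colorable_image genH inM in_inj cG.
  move=> r; apply: coloring_HNN => //; exact: (colorable_image genH inM in_inj cN).
have := colorable_image genT (f := id) _ _ cH; rewrite image_id; apply => //.
Qed.

Lemma asdim_le_HNN (R : realType) (G : groupType) (S : seq G) (genS : generates S)
    (N : groupClosed G) (phi : {multiplicative subgroup N -> G})
    (phi_inj : injective phi) (T : seq (HNN phi)) (genT : generates T) n m :
    asdim_le (word_space R genS) n ->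
    asdim_le (set_type [set g : word_space R genS | (g : G) \in N]) m ->
  asdim_le (word_space R genT) (maxn n m.+1).
Proof.
move=> Gn Nm; apply: colorable_asdim_le; apply: (colorable_HNN (genS := genS) phi_inj).
- apply: (@colorable_widen _ _ _ n.+1); first by rewrite ltnS leq_maxl.
  apply: (sub_colorable (Y := range (fun g : word_space R genS => g : G))).
    by move=> g _; exists g.
  apply: (@asdim_le_colorable R G S genS (word_space R genS) (1%g : G)
    (fun g => g) n _ Gn).
  by move=> x y; exact: mdist_word_space.
- apply: (@colorable_widen _ _ _ m.+1); first exact: leq_maxr.
  set A := (X in set_type X) in Nm.
  have A1 : A (1%g : G) by exact: gpred1.
  apply: (sub_colorable (Y := range (fun g : A => set_val g : G))).
    by move=> g gN; exists (SigSub (mem_set (gN : A g))).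
  apply: (@asdim_le_colorable R G S genS (set_type A) (SigSub (mem_set A1))
    (fun g => set_val g : G) m _ Nm).
  by move=> x y; exact: mdist_word_space.
Qed.

Theorem theorem1p1 (R : realType) (G : groupType) (S : seq G)
    (genS : generates S) (N : groupClosed G)
    (phi : {multiplicative subgroup N -> G}) (phi_inj : injective phi)
    (T : seq (HNN phi)) (genT : generates T) :
  asdim (word_space R genT) <=
    maxe (asdim (word_space R genS))
         (asdim (set_type [set g : word_space R genS | (g : G) \in N]) + 1).
Proof.
set NX := set_type _.
have [[n0 Gn0]|nG] := pselect (exists n, asdim_le (word_space R genS) n); last first.
  by rewrite (asdim_pinfty nG) maxye leey.
have [[m0 Nm0]|nN] := pselect (exists m, asdim_le NX m); last first.
  by rewrite (asdim_pinfty nN) maxey leey.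
have [n Gn ->] := asdim_attained Gn0; have [m Nm ->] := asdim_attained Nm0.
have := asdim_le_HNN phi_inj genT Gn Nm => HNNnm.
apply: (@Order.POrderTheory.le_trans _ _ ((maxn n m.+1)%:R%:E)).
  by apply: ereal_inf_lbound; exists (maxn n m.+1).
by rewrite -EFinD -EFin_max lee_fin GRing.natr1 -maxEnat Num.Theory.natr_max.
Qed.
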